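(* Let $G$ be an infinite, connected, vertex-transitive graph with all degrees at most a finite constant $D$, and let $o$ be any vertex of $G$. Then the matching measure $\nu_{G,o}$ has no atoms, that is, $\nu_{G,o}(\{\theta\})=0$ for every $\theta\in\mathbb{R}$.
   Context: For a graph $G$ of maximum degree at most $D$ and a vertex $u$, let $\mathcal{P}(u)$ be the set of finite paths in $G$ (sequences of distinct vertices, consecutive ones adjacent) starting at $u$. The path tree $T(G,u)$ has vertex set $\mathcal{P}(u)$, two paths being adjacent iff one is obtained from the other by deleting its last vertex. Let $A$ be the adjacency operator of $T(G,u)$ on $\ell^2(\mathcal{P}(u))$ (bounded, self-adjoint) and $\chi_u$ the indicator of the one-vertex path $u$. The matching measure $\nu_{G,u}$ is the unique probability measure on $[-D,D]$ with $\langle A^n\chi_u,\chi_u\rangle=\int x^n\,d\nu_{G,u}(x)$ for all $n\ge 1$. *)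

(* Defs.v *)
From mathcomp Require Import all_boot all_order all_algebra.
From mathcomp Require Import all_classical all_reals all_analysis.
Set Implicit Arguments. Unset Strict Implicit. Unset Printing Implicit Defensive.
Import Order.TTheory GRing.Theory Num.Theory.
Local Open Scope classical_set_scope.
Local Open Scope ring_scope.

Definition simple_graph (V : Type) (adj : rel V) : Prop :=
  (forall x y, adj x y = adj y x) /\ (forall x, ~~ adj x x).

Definition max_degree_le (V : eqType) (adj : rel V) (D : nat) : Prop :=
  forall v, exists s : seq V, [/\ uniq s, (size s <= D)%N & forall w, adj v w = (w \in s)].

Definition connected_graph (V : eqType) (adj : rel V) : Prop :=
  forall x y, exists s : seq V, path adj x s /\ last x s = y.

Definition graph_automorphism (V : Type) (adj : rel V) (f : V -> V) : Prop :=
  bijective f /\ forall x y, adj (f x) (f y) = adj x y.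

Definition vertex_transitive (V : Type) (adj : rel V) : Prop :=
  forall x y, exists f, graph_automorphism adj f /\ f x = y.

(* A path starting at u is encoded by its tail s: the path is u :: s,
   a sequence of distinct vertices with consecutive ones adjacent. *)
Definition is_path_from (V : eqType) (adj : rel V) (u : V) (s : seq V) : Prop :=
  path adj u s /\ uniq (u :: s).

Definition path_tree_adj (V : eqType) (adj : rel V) (u : V) (s t : seq V) : Prop :=
  is_path_from adj u s /\ is_path_from adj u t /\
  ((exists x, t = rcons s x) \/ (exists x, s = rcons t x)).

Definition path_tree_op (R : realType) (V : choiceType) (adj : rel V) (u : V)
    (g : seq V -> R) : seq V -> R :=
  fun s => \sum_(t \in [set t | path_tree_adj adj u s t]) g t.

Definition root_indicator (R : realType) (V : eqType) : seq V -> R :=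
  fun s => if s == [::] then 1 else 0.

(* <A^n chi_u, chi_u> = (A^n chi_u)(root). *)
Definition path_tree_moment (R : realType) (V : choiceType) (adj : rel V) (u : V)
    (n : nat) : R :=
  iter n (path_tree_op adj u) (@root_indicator R V) [::].

Definition is_matching_measure (R : realType) (V : choiceType) (adj : rel V)
    (D : nat) (u : V) (nu : probability R R) : Prop :=
  nu (`[- (D%:R : R), D%:R]%classic) = 1%E /\
  forall n : nat, (0 < n)%N ->
    (\int[nu]_x ((x ^+ n)%:E) = (@path_tree_moment R V adj u n)%:E)%E.

(* Main.v *)
(** Fix [z = th + i t] with [t > 0] and let [M S] be the matching polynomial at [z] of the graph
    induced on a finite set [S]. With [m_u = M (S - u) / M S] and [m_uv = M (S - u - v) / M S],
    Heilmann and Lieb's identity writes [m_u m_v - m_uv] as the sum of [(M (S - P) / M S)^2] over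
    the paths [P] from [u] to [v], and the squared moduli [|M (S - P) / M S|^2] over all paths
    from [u] sum up to [- Im m_u / t <= 1 / t^2]. Hence
    [\sum_v t^2 |m_u m_v - m_uv| <= 1], and if all [t |m_v|] stay above some [a > 0] while
    [t^2 m_uv] tends to 0 with [t] for all [u <> v], there are at most [1 / a^2] vertices.

    That [t^2 m_uv] tends to 0 is immediate for adjacent [u], [v]; a polarization of the
    Heilmann-Lieb identity in three vertices makes the relation "[t^2 m_uv] tends to 0"
    transitive, so connectedness gives it for all pairs (this is Gallai's lemma).

    Finally, an atom of mass [c] at [th] forces [t |m_v| >= c / 2] as soon as [S] contains a large
    ball around [v]: the vector [(M (S - P) / M S)_P] inverts [z - A] on paths that stay away from
    the boundary of [S], and is paired with [p(A) chi_v] for a polynomial [p] close to the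
    indicator of [th] on [[-D, D]]. By transitivity all vertices have the same moments, so [c] is
    the same for all of them. *)

Require Import Defs.
From mathcomp Require Import all_boot all_order all_algebra.
From mathcomp Require Import all_classical all_reals all_analysis.
From mathcomp Require Import measurable_realfun.
From mathcomp Require Import finmap complex zify ring lra.
Set Implicit Arguments. Unset Strict Implicit. Unset Printing Implicit Defensive.
Import Order.TTheory GRing.Theory Num.Theory.
Import Normc.
Local Open Scope classical_set_scope.
Local Open Scope fset_scope.
Local Open Scope ring_scope.
Local Notation Re := complex.Re.
Local Notation Im := complex.Im.

(** * Sums over finite sets with deleted points *)

Lemma exchange_sum_fsetD1 (V : choiceType) (K : nmodType) (T : {fset V}) (P Q : pred V)
    (F : V -> V -> K) :
  \sum_(v <- T | P v) \sum_(w <- T `\ v | Q w) F v w =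
  \sum_(w <- T | Q w) \sum_(v <- T `\ w | P v) F v w.
Proof.
have mkif (P' Q' : pred V) (F' : V -> V -> K) :
  \sum_(v <- T | P' v) \sum_(w <- T `\ v | Q' w) F' v w =
  \sum_(v <- T) \sum_(w <- T) if [&& P' v, Q' w & v != w] then F' v w else 0.
  rewrite big_mkcond /=; apply: eq_big_seq => v vT.
  case: ifP => av; last by rewrite big1.
  rewrite [RHS](big_fsetD1 v) //= eqxx andbF add0r big_mkcond /=.
  by apply: eq_big_seq => w; rewrite !inE => /andP[wv wT]; rewrite eq_sym wv andbT.
rewrite !mkif exchange_big /=; apply: eq_bigr => v _; apply: eq_bigr => w _.
by rewrite andbCA eq_sym.
Qed.

Lemma sum_fsetD1 (V : choiceType) (K : nmodType) (S : {fset V}) (u : V) (P : pred V)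
    (F : V -> K) : u \in S ->
  \sum_(v <- S | P v) F v = (if P u then F u else 0) + \sum_(v <- S `\ u | P v) F v.
Proof. by move=> uS; rewrite big_mkcond (big_fsetD1 u) //= -big_mkcond. Qed.

Lemma fsetD1C (V : choiceType) (S : {fset V}) (u v : V) : S `\ u `\ v = S `\ v `\ u.
Proof. by rewrite !fsetDDl fsetUC. Qed.

(** * The matching polynomial of a finite induced subgraph *)

Section MatchingPolynomial.
Variables (V : choiceType) (adj : rel V) (K : comNzRingType) (z : K).

(** For symmetric [adj] and fuel [n] at least the size of [S], this is the sum of
    [(-1)^k z^(|S| - 2k)] over the matchings of [S], [k] being the number of edges. *)
Fixpoint matching_rec (n : nat) (S : {fset V}) : K :=
  if n is n'.+1 then
    if enum_fset S is u :: _ then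
      z * matching_rec n' (S `\ u)
      - \sum_(v <- S `\ u | adj u v) matching_rec n' (S `\ u `\ v)
    else 1
  else 1.

Definition matching_poly (S : {fset V}) : K := matching_rec #|` S| S.

Lemma matching_rec_stable n m (S : {fset V}) :
  (#|` S| <= n)%N -> (#|` S| <= m)%N -> matching_rec n S = matching_rec m S.
Proof.
have rec0 k (T : {fset V}) : (#|` T| <= 0)%N -> matching_rec k T = 1.
  by case: k => //= k; rewrite leqn0 => /eqP/size0nil ->.
elim: n m S => [|n IH] m S; first by move=> S0 _; rewrite !rec0.
case: m => [_ S0|m Sn Sm /=]; first by rewrite !rec0.
case E: (enum_fset S) => [//|u s].
have uS : u \in S by rewrite -[u \in S]/(u \in enum_fset S) E mem_head.
have := cardfsD1 u S; rewrite uS add1n => cS.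
have D1 k (x : V) : (#|` S| <= k.+1)%N -> (#|` S `\ u `\ x| <= k)%N.
  by rewrite cS ltnS => h; apply: leq_trans h; apply/fsubset_leq_card/fsubD1set.
rewrite (IH m) ?(leq_trans _ Sn) //; last 2 first.
- by rewrite -ltnS -cS.
- by rewrite -ltnS -cS.
by congr (_ - _); apply: eq_bigr => v _; apply: IH; apply: D1.
Qed.

Lemma matching_poly0 : matching_poly fset0 = 1.
Proof. by rewrite /matching_poly cardfs0. Qed.

Hypothesis adjC : symmetric adj.

(** The definition expands at one particular vertex of each set. Expanding there and then at [u]
    gives an expression symmetric in the two vertices, so [u] may equally come first. *)
Lemma matching_polyD1 (S : {fset V}) (u : V) : u \in S ->
  matching_poly S = z * matching_poly (S `\ u)
    - \sum_(v <- S `\ u | adj u v) matching_poly (S `\ u `\ v).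
Proof.
have [n] := ubnP #|` S|; elim: n S u => // n IH S u /ltnSE Sn uS.
have cS w : w \in S -> #|` S| = (#|` S `\ w|).+1.
  by move=> wS; rewrite (cardfsD1 w S) wS.
have lt_n w : w \in S -> (#|` S `\ w| < n)%N by move=> /cS; lia.
have [x xS Ex] : exists2 x, x \in S & matching_poly S = z * matching_poly (S `\ x)
    - \sum_(v <- S `\ x | adj x v) matching_poly (S `\ x `\ v).
  have := cS u uS; rewrite {1}/matching_poly => -> /=.
  case E: (enum_fset S) => [|x s].
    by move: uS; rewrite -[u \in S]/(u \in enum_fset S) E.
  have xS : x \in S by rewrite -[x \in S]/(x \in enum_fset S) E mem_head.
  exists x => //; rewrite /matching_poly.
  have cxu : #|` S `\ u| = #|` S `\ x| by apply/eqP; rewrite -eqSS -!cS.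
  rewrite cxu; congr (_ - _); apply: eq_bigr => v _; apply: matching_rec_stable => //.
  exact/fsubset_leq_card/fsubD1set.
have [<-//|xu] := eqVneq x u.
pose T := S `\ x `\ u.
(* Expansion at [a], then at [b]; its symmetry comes from [adjC] and [exchange_sum_fsetD1]. *)
pose E2 a b := z * (z * matching_poly T - \sum_(w <- T | adj b w) matching_poly (T `\ w))
   - (if adj a b then matching_poly T else 0)
   - \sum_(v <- T | adj a v) (z * matching_poly (T `\ v)
        - \sum_(w <- T `\ v | adj b w) matching_poly (T `\ v `\ w)).
have ST : S `\ u `\ x = T by rewrite fsetD1C.
have expand a b : a \in S -> b \in S -> a != b -> S `\ a `\ b = T ->
    z * matching_poly (S `\ a) - \sum_(v <- S `\ a | adj a v) matching_poly (S `\ a `\ v)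
    = E2 a b.
  move=> aS bS ab SabT.
  have bSa : b \in S `\ a by rewrite !inE eq_sym ab bS.
  rewrite (IH _ b (lt_n a aS) bSa) SabT (sum_fsetD1 _ _ bSa) SabT /E2.
  rewrite opprD addrA; congr (_ - _).
  rewrite big_seq_cond [RHS]big_seq_cond; apply: eq_bigr => v /andP[vT _].
  have vSa : v \in S `\ a by move: vT; rewrite -SabT !inE => /and3P[_ -> ->].
  have vb : v != b by move: vT; rewrite -SabT !inE => /and3P[].
  have eqT : S `\ a `\ v `\ b = T `\ v by rewrite -SabT fsetD1C.
  rewrite (IH _ b) ?eqT //.
    apply: leq_ltn_trans (lt_n a aS); exact/fsubset_leq_card/fsubD1set.
  by rewrite in_fsetD1 eq_sym vb bSa.
rewrite Ex (expand x u) // (expand u x) // 1?eq_sym // /E2 adjC.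
rewrite !sumrB -!mulr_sumr [in RHS]exchange_sum_fsetD1 /=.
under [X in _ - (_ - X) = _]eq_bigr do under eq_bigr do rewrite fsetD1C.
ring.
Qed.

End MatchingPolynomial.

(** * Heilmann-Lieb identities in two and three vertices *)

Section HeilmannLieb.
Variables (V : choiceType) (adj : rel V) (adjC : symmetric adj) (K : comNzRingType) (z : K).
Local Notation M := (matching_poly adj z).

(** Equals [(M S)^2 (m_u m_v - m_uv)], kept free of division. *)
Definition pair_defect (S : {fset V}) (u v : V) : K :=
  M (S `\ u) * M (S `\ v) - M S * M (S `\ u `\ v).

(** Expand [M S] and [M (S - v)] at [u]: the [z] terms cancel. Iterating yields the sum of
    [M (S - P)^2] over paths [P] from [u] to [v]. *)
Lemma pair_defectD1 (S : {fset V}) (u v : V) : u \in S -> v \in S -> u != v ->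
  pair_defect S u v = (if adj u v then M (S `\ u `\ v) ^+ 2 else 0)
    + \sum_(w <- S `\ u `\ v | adj u w) pair_defect (S `\ u) w v.
Proof.
move=> uS vS uv.
have vSu : v \in S `\ u by rewrite !inE eq_sym uv.
have uSv : u \in S `\ v by rewrite !inE uv.
rewrite /pair_defect (matching_polyD1 z adjC uS) (matching_polyD1 z adjC uSv) (sum_fsetD1 _ _ vSu).
rewrite sumrB -mulr_suml -!mulr_sumr (fsetD1C S v u).
under [X in _ = _ + (_ - _ * X)]eq_bigr do rewrite fsetD1C.
by case: ifP => _; ring.
Qed.

(* Giving [w] the weight [z + x] instead of [z] replaces [M S] by [M S + x M (S - w)]; this is the
   coefficient of [x] in the resulting [pair_defect S s u]. *)
Definition triple_defect (S : {fset V}) (s u w : V) : K :=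
  M (S `\ s) * M (S `\ u `\ w) + M (S `\ u) * M (S `\ s `\ w)
  - M (S `\ w) * M (S `\ s `\ u) - M S * M (S `\ s `\ u `\ w).

(** First-order variation of [pair_defectD1] in the weight of [w]. Paths through [w] are unaffected,
    so iterating yields the sum of [2 M (S - P) M (S - P - w)] over paths [P] from [s] to [u]
    avoiding [w]. *)
Lemma triple_defectD1 (S : {fset V}) (s u w : V) : s \in S -> u \in S -> w \in S ->
  s != u -> s != w -> u != w ->
  triple_defect S s u w =
    (if adj s u then 2%:R * (M (S `\ s `\ u) * M (S `\ s `\ u `\ w)) else 0)
    + \sum_(x <- S `\ s `\ u `\ w | adj s x) triple_defect (S `\ s) x u w.
Proof.
move=> sS uS wS su sw uw.
have uSs : u \in S `\ s by rewrite !inE eq_sym su.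
have wSs : w \in S `\ s by rewrite !inE eq_sym sw.
have sSu : s \in S `\ u by rewrite !inE su.
have sSw : s \in S `\ w by rewrite !inE sw.
have sSuw : s \in S `\ u `\ w by rewrite !inE su sw.
have wSsu : w \in S `\ s `\ u by rewrite in_fsetD1 eq_sym uw.
have uSsw : u \in S `\ s `\ w by rewrite in_fsetD1 uw.
rewrite /triple_defect (matching_polyD1 z adjC sS) (matching_polyD1 z adjC sSu).
rewrite (matching_polyD1 z adjC sSw) (matching_polyD1 z adjC sSuw).
have e1 : S `\ u `\ w `\ s = S `\ s `\ u `\ w by rewrite (fsetD1C _ w) (fsetD1C _ u).
have e2 : S `\ s `\ w `\ u = S `\ s `\ u `\ w by rewrite fsetD1C.
rewrite e1 !(fsetD1C S _ s).
rewrite (sum_fsetD1 _ _ uSs) (sum_fsetD1 _ _ uSsw) !(sum_fsetD1 _ _ wSsu) e2.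
rewrite !sumrB !big_split /= -!mulr_suml -!mulr_sumr.
have ex (y : V) T : \sum_(x <- T | adj s x) M (S `\ s `\ x `\ y) =
   \sum_(x <- T | adj s x) M (S `\ s `\ y `\ x).
  by apply: eq_bigr => x _; rewrite fsetD1C.
rewrite !ex.
have -> : \sum_(x <- S `\ s `\ u `\ w | adj s x) M (S `\ s `\ x `\ u `\ w) =
  \sum_(x <- S `\ s `\ u `\ w | adj s x) M (S `\ s `\ u `\ w `\ x).
  by apply: eq_bigr => x _; rewrite (fsetD1C _ x) (fsetD1C _ x).
by do 2 case: ifP => _; ring.
Qed.

End HeilmannLieb.

(** * The modulus and the form [Im (x conj y)] *)

Section ComplexModulus.
Variable R : rcfType.
Implicit Types x y : R[i].

Lemma normc_ge0 x : 0 <= normc x.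
Proof. by case: x => a b; exact: sqrtr_ge0. Qed.

Lemma sqr_normc x : normc x ^+ 2 = Re x ^+ 2 + Im x ^+ 2.
Proof. by case: x => a b /=; rewrite sqr_sqrtr // addr_ge0 ?sqr_ge0. Qed.

Lemma normcD x y : normc (x + y) <= normc x + normc y.
Proof. exact: le_normcD. Qed.

Lemma normcB x y : normc (x - y) <= normc x + normc y.
Proof. by apply: le_trans (normcD _ _) _; rewrite normcN. Qed.

Lemma normc_sum (I : Type) (s : seq I) (P : pred I) (F : I -> R[i]) :
  normc (\sum_(i <- s | P i) F i) <= \sum_(i <- s | P i) normc (F i).
Proof.
elim/big_rec2: _ => [|i a b _ ba]; first by rewrite normc0.
by apply: le_trans (normcD _ _) _; rewrite lerD2l.
Qed.

Definition im_mul_conj x y : R := Im x * Re y - Re x * Im y.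

Lemma im_mul_conjBl x y w : im_mul_conj (x - y) w = im_mul_conj x w - im_mul_conj y w.
Proof. by case: x y w => [a b] [c d] [e f]; rewrite /im_mul_conj /=; ring. Qed.

Lemma im_mul_conj_suml (I : Type) (s : seq I) (P : pred I) (F : I -> R[i]) w :
  im_mul_conj (\sum_(i <- s | P i) F i) w = \sum_(i <- s | P i) im_mul_conj (F i) w.
Proof.
elim/big_rec2: _ => [|i a b _ <-]; first by rewrite /im_mul_conj /= !mul0r subr0.
by case: (F i) b w => [c d] [e f] [g h]; rewrite /im_mul_conj /=; ring.
Qed.

Lemma im_mul_conjC x y : im_mul_conj x y = - im_mul_conj y x.
Proof. by rewrite /im_mul_conj; ring. Qed.

Lemma im_mul_conj_le x y : im_mul_conj x y <= normc x * normc y.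
Proof.
apply: le_trans (ler_norm _) _.
rewrite -(@ler_pXn2r _ 2) ?nnegrE ?mulr_ge0 ?normc_ge0 //.
rewrite exprMn !sqr_normc real_normK ?num_real // /im_mul_conj.
have := sqr_ge0 (Im x * Im y + Re x * Re y); nra.
Qed.

End ComplexModulus.

(** * Estimates for matching polynomials off the real axis *)

Section ResolventEstimates.
Variables (V : choiceType) (adj : rel V) (adjC : symmetric adj).
Variables (R : rcfType) (th t : R) (t0 : 0 < t).
Local Notation M := (matching_poly adj (th +i* t)%C).
Local Notation N x := (normc x).

(* [weight S u = |M S|^2 Im (- M (S - u) / M S)]. It equals [t] times the sum of [|M (S - P)|^2]
   over all paths [P] in [S] starting at [u]. *)
Definition weight (S : {fset V}) (u : V) : R := im_mul_conj (M S) (M (S `\ u)).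

(** Expanding [M S] at [u], the [z] term contributes [Im z = t] times a square; antisymmetry of
    [im_mul_conj] absorbs the minus sign of the other terms. *)
Lemma weightD1 (S : {fset V}) (u : V) : u \in S ->
  weight S u = t * N (M (S `\ u)) ^+ 2 + \sum_(v <- S `\ u | adj u v) weight (S `\ u) v.
Proof.
move=> uS; rewrite /weight (matching_polyD1 _ adjC uS) im_mul_conjBl im_mul_conj_suml.
congr (_ + _).
  by rewrite sqr_normc; case: (M _) => a b; rewrite /im_mul_conj /=; ring.
by rewrite -sumrN; apply: eq_bigr => v _; rewrite [RHS]im_mul_conjC.
Qed.

Lemma fset_ind_D1 (P : {fset V} -> Prop) :
  (forall S, (forall u, u \in S -> P (S `\ u)) -> P S) -> forall S, P S.
Proof.
move=> H S; have [n] := ubnP #|` S|; elim: n S => // n IH S /ltnSE Sn.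
by apply: H => u uS; apply: IH; move: Sn; rewrite (cardfsD1 u S) uS add1n.
Qed.

Lemma weight_ge (S : {fset V}) (u : V) : u \in S -> t * N (M (S `\ u)) ^+ 2 <= weight S u.
Proof.
elim/fset_ind_D1: S u => S IH u uS; rewrite weightD1 // lerDl.
rewrite big_seq_cond; apply: sumr_ge0 => v /andP[vS _].
by apply: le_trans (IH u uS v vS); rewrite mulr_ge0 ?sqr_ge0 // ltW.
Qed.

Lemma weight_ge0 (S : {fset V}) (u : V) : u \in S -> 0 <= weight S u.
Proof. by move/weight_ge; apply: le_trans; rewrite mulr_ge0 ?sqr_ge0 // ltW. Qed.

Lemma weight_le (S : {fset V}) (u : V) : weight S u <= N (M S) * N (M (S `\ u)).
Proof. exact: im_mul_conj_le. Qed.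

Lemma weight_adj_le (S : {fset V}) (u v : V) : u \in S -> v \in S `\ u -> adj u v ->
  weight (S `\ u) v <= weight S u.
Proof.
move=> uS vS uv; rewrite [leRHS]weightD1 // (sum_fsetD1 _ _ vS) uv addrCA lerDl.
apply: addr_ge0; first by rewrite mulr_ge0 ?sqr_ge0 // ltW.
rewrite big_seq_cond; apply: sumr_ge0 => w; rewrite !inE => /andP[/andP[_ wS] _].
by apply: weight_ge0; rewrite !inE.
Qed.

(** If [M S] vanished, [weight S u] would be at most 0, yet it is at least [t |M (S - u)|^2],
    positive by induction. This is Heilmann and Lieb's real-rootedness. *)
Lemma normc_matching_gt0 (S : {fset V}) : 0 < N (M S).
Proof.
elim/fset_ind_D1: S => S IH; have [->|[u uS]] := fset_0Vmem S.
  by rewrite matching_poly0 normc1.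
have p := IH u uS; rewrite lt_def normc_ge0 andbT; apply/eqP => M0.
have := le_trans (weight_ge uS) (weight_le S u); rewrite M0 mul0r leNgt.
by rewrite mulr_gt0 // exprn_gt0.
Qed.

Lemma normc_matchingD1 (S : {fset V}) (u : V) : u \in S -> t * N (M (S `\ u)) <= N (M S).
Proof.
move=> uS; rewrite -(ler_pM2r (normc_matching_gt0 (S `\ u))) -mulrA -expr2.
exact: le_trans (weight_ge uS) (weight_le S u).
Qed.

(** The path [u, v] is among those counted by [weight S u], which is at most [|M S|^2 / t]. Hence
    [t^2 |m_uv| <= t], the base case of Gallai's lemma. *)
Lemma normc_matching_adj (S : {fset V}) (u v : V) : u \in S -> v \in S `\ u -> adj u v ->
  t * N (M (S `\ u `\ v)) <= N (M S).
Proof.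
move=> uS vS uv.
rewrite -(@ler_pXn2r _ 2) ?nnegrE ?mulr_ge0 ?normc_ge0 // ?(ltW t0) //.
rewrite exprMn expr2 -mulrA.
have h1 := le_trans (weight_ge vS) (weight_adj_le uS vS uv).
have h2 := normc_matchingD1 uS.
have h3 := weight_le S u; have := normc_ge0 (M S); have := t0; nra.
Qed.

(** By the triangle inequality the defect is at most the sum of [|M (S - P)|^2] over paths from [u]
    to [v]. Over all [v] these are the nontrivial paths counted by [weight S u]; the trivial one
    gives the separate square. *)
Lemma sum_pair_defect_le (S : {fset V}) (u : V) : u \in S ->
  t * (N (M (S `\ u)) ^+ 2 + \sum_(v <- S `\ u) N (pair_defect adj (th +i* t)%C S u v))
  <= weight S u.
Proof.
elim/fset_ind_D1: S u => S IH u uS; rewrite weightD1 // mulrDr lerD2l.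
have : \sum_(v <- S `\ u) N (pair_defect adj (th +i* t)%C S u v) <=
   \sum_(v <- S `\ u | adj u v) N (M (S `\ u `\ v)) ^+ 2 +
   \sum_(v <- S `\ u) \sum_(w <- S `\ u `\ v | adj u w)
      N (pair_defect adj (th +i* t)%C (S `\ u) w v).
  rewrite [X in _ <= X + _]big_mkcond -big_split /= big_seq [leRHS]big_seq.
  apply: ler_sum => v; rewrite !inE => /andP[vu vS].
  rewrite pair_defectD1 // 1?eq_sym //; apply: le_trans (normcD _ _) _.
  apply: lerD; last exact: normc_sum.
  by case: ifP => _; rewrite ?normc0 // expr2 normcM expr2.
move/(ler_wpM2l (ltW t0))/le_trans; apply.
rewrite (@exchange_sum_fsetD1 _ _ _ xpredT) -big_split mulr_sumr /=.
rewrite big_seq_cond [leRHS]big_seq_cond; apply: ler_sum => w /andP[wS _].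
exact: IH.
Qed.

(** AM-GM with ratio [l] on [2 |M (S - P)| |M (S - P - w)|], summed over paths avoiding [w]; [l]
    stays free to balance weights of different size. *)
Lemma triple_defect_le (l : R) (S : {fset V}) (s u w : V) : 0 < l ->
  s \in S -> u \in S -> w \in S -> s != u -> s != w -> u != w ->
  t * N (triple_defect adj (th +i* t)%C S s u w)
  <= l * weight S s + l^-1 * weight (S `\ w) s.
Proof.
move=> l0; elim/fset_ind_D1: S s => S IH s sS uS wS su sw uw.
have uSs : u \in S `\ s by rewrite !inE eq_sym su.
have wSs : w \in S `\ s by rewrite !inE eq_sym sw.
have uSsw : u \in S `\ s `\ w by rewrite in_fsetD1 uw.
have sSw : s \in S `\ w by rewrite !inE sw.
have li : 0 < l^-1 by rewrite invr_gt0.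
have lV : l * l^-1 = 1 by rewrite divff ?gt_eqF.
rewrite !weightD1 // (fsetD1C S w).
set a := N (M (S `\ s)); set b := N (M (S `\ s `\ w)).
(* Discarded here: the trivial path in both weights, and the paths in [S] whose first step goes to
   [w]. *)
suff : t * N (triple_defect adj (th +i* t)%C S s u w) <=
   \sum_(v <- S `\ s `\ w | adj s v) (l * weight (S `\ s) v + l^-1 * weight (S `\ s `\ w) v).
  move/le_trans; apply; rewrite big_split /= -!mulr_sumr !mulrDr.
  have h1 : 0 <= l * (t * a ^+ 2) by do 2 (apply: mulr_ge0; first exact: ltW); exact: sqr_ge0.
  have h2 : 0 <= l^-1 * (t * b ^+ 2) by do 2 (apply: mulr_ge0; first exact: ltW); exact: sqr_ge0.
  have h3 : l * \sum_(v <- S `\ s `\ w | adj s v) weight (S `\ s) v <=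
       l * \sum_(v <- S `\ s | adj s v) weight (S `\ s) v.
    rewrite ler_pM2l // [leRHS](sum_fsetD1 _ _ wSs) lerDr.
    by case: ifP => // _; apply: weight_ge0.
  lra.
rewrite triple_defectD1 // (sum_fsetD1 _ _ uSsw) (fsetD1C _ w).
apply: le_trans (ler_wpM2l (ltW t0) (normcD _ _)) _; rewrite mulrDr; apply: lerD.
  case: ifP => _; last by rewrite normc0 mulr0.
  have := weight_ge uSs; have := weight_ge uSsw; rewrite (fsetD1C _ w).
  have -> : 2%:R = (2%:R +i* 0)%C :> R[i] by rewrite mulrSr /= ; congr Complex; rewrite ?addr0.
  rewrite !normcM /= expr0n /= addr0 sqrtr_sqr ger0_norm //.
  set d := N _; set c := N _ => h1 h2.
  apply: le_trans (lerD (ler_wpM2l (ltW l0) h2) (ler_wpM2l (ltW li) h1)).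
  have := mulr_ge0 (ltW t0) (mulr_ge0 (ltW li) (sqr_ge0 (l * c - d))).
  have -> : t * (l^-1 * (l * c - d) ^+ 2) =
    t * (l * l^-1) * (l * c ^+ 2) + l^-1 * (t * d ^+ 2) - 2 * t * (l * l^-1) * (c * d) by ring.
  by rewrite lV; lra.
apply: le_trans (ler_wpM2l (ltW t0) (normc_sum _ _ _)) _; rewrite mulr_sumr.
rewrite big_seq_cond [leRHS]big_seq_cond; apply: ler_sum => x.
rewrite !inE => /andP[/and4P[xw xu xs xS] _].
by rewrite (fsetD1C S s); apply: le_trans (IH _ _ _ _ _ _ _ _ _) _;
  rewrite ?inE ?xs ?xS ?xu ?xw ?sw ?su ?uS ?wS // 1?eq_sym ?sw ?su // fsetD1C.
Qed.

End ResolventEstimates.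

(** * Decorrelation along paths and the counting bound *)

Section FiniteGraphBounds.
Variables (V : choiceType) (adj : rel V) (adjC : symmetric adj).
Variables (R : rcfType) (th a : R).
Local Notation N x := (normc x).

Section FixedHeight.
Variable t : R.
Hypothesis t0 : 0 < t.
Local Notation M := (matching_poly adj (th +i* t)%C).

(** Gallai's transitivity with an explicit error. [triple_defect] involves [m_s m_uw], [m_w m_su]
    and terms in [m_sw] and [m_suw] that are small since [s] and [w] are adjacent; [t |m_s| >= a]
    then lets one solve for [m_uw]. *)
Lemma chain_step (tau : R) (S : {fset V}) (s u w : V) : t = tau ^+ 2 -> 0 < tau <= 1 ->
  s \in S -> u \in S -> w \in S -> s != u -> s != w -> u != w -> adj s w ->
  a * N (M S) <= t * N (M (S `\ s)) ->
  a * (t ^+ 2 * N (M (S `\ u `\ w)))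
    <= t ^+ 2 * N (M (S `\ u `\ s)) + 4 * tau * N (M S).
Proof.
move=> tE /andP[tau0 tau1] sS uS wS su sw uw asw am.
have sSw : s \in S `\ w by rewrite !inE sw.
have wSs : w \in S `\ s by rewrite !inE eq_sym sw.
have uSsw : u \in S `\ s `\ w by rewrite !inE uw eq_sym su.
have m0 := normc_matching_gt0 adjC th t0 S.
have tv : 0 < tau^-1 by rewrite invr_gt0.
(* The two weights are at most [|M S|^2 / t] and [|M S|^2 / t^2]; with [l = 1 / tau] and
   [t = tau^2], each contributes at most [tau |M S|^2] after multiplication by [t^2]. *)
have T := triple_defect_le adjC th t0 tv sS uS wS su sw uw.
have wS1 := weight_le adj th t S s; have wS2 := weight_le adj th t (S `\ w) s.
have B1 := normc_matchingD1 adjC th t0 sS; have B2 := normc_matchingD1 adjC th t0 uS.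
have B3 := normc_matchingD1 adjC th t0 wS.
have B4 := normc_matching_adj adjC th t0 sS wSs asw.
have B5 := normc_matchingD1 adjC th t0 uSsw.
move: T wS1 wS2; rewrite invrK (fsetD1C S w) (fsetD1C S u s).
have e : S `\ s `\ w `\ u = S `\ s `\ u `\ w by rewrite fsetD1C.
rewrite e in B5.
have tri : N (M (S `\ s)) * N (M (S `\ u `\ w)) <=
   N (triple_defect adj (th +i* t)%C S s u w) + (N (M (S `\ u)) * N (M (S `\ s `\ w))
   + N (M (S `\ w)) * N (M (S `\ s `\ u)) + N (M S) * N (M (S `\ s `\ u `\ w))).
  rewrite -!normcM.
  set x := M (S `\ s) * _.
  have -> : x = triple_defect adj (th +i* t)%C S s u w
     - (M (S `\ u) * M (S `\ s `\ w) - M (S `\ w) * M (S `\ s `\ u)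
        - M S * M (S `\ s `\ u `\ w)) by rewrite /x /triple_defect; ring.
  apply: le_trans (normcB _ _) _; rewrite lerD2l.
  by apply: le_trans (normcB _ _) _; rewrite lerD2r; exact: normcB.
move: tri am B1 B2 B3 B4 B5.
have n0 (x : R[i]) := normc_ge0 x.
move: (n0 (M (S `\ s))) (n0 (M (S `\ u))) (n0 (M (S `\ w))) (n0 (M (S `\ u `\ w)))
  (n0 (M (S `\ s `\ u))) (n0 (M (S `\ s `\ w))) (n0 (M (S `\ s `\ u `\ w))).
move: (weight adj th t S s) (weight adj th t (S `\ w) s).
move: (N (triple_defect adj (th +i* t)%C S s u w)) m0.
move: (N (M (S `\ s))) (N (M (S `\ u))) (N (M (S `\ w))) (N (M (S `\ u `\ w)))
  (N (M (S `\ s `\ u))) (N (M (S `\ s `\ w))) (N (M (S `\ s `\ u `\ w))) (N (M S)).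
move=> s1 u1 w1 uw1 su1 sw1 suw1 m D m0 W1 W2 s10 u10 w10 uw10 su10 sw10 suw10.
move=> tri am B1 B2 B3 B4 B5 T wS1 wS2.
have tt : t <= tau by rewrite tE; nra.
rewrite -(ler_pM2r m0).
have k1 : a * (t ^+ 2 * uw1) * m <= t ^+ 3 * (s1 * uw1).
  have : 0 <= t ^+ 2 * uw1 by rewrite mulr_ge0 // exprn_ge0 // ltW.
  by move/(ler_wpM2r)/(_ _ _ am); rewrite [t ^+ 3]exprS; lra.
apply: le_trans k1 _.
apply: le_trans (ler_wpM2l _ tri) _; first by rewrite exprn_ge0 // ltW.
have k2 : t ^+ 3 * (u1 * sw1) <= t * m ^+ 2.
  have := ler_pM (mulr_ge0 (ltW t0) u10) (mulr_ge0 (ltW t0) sw10) B2 B4.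
  by move/(ler_wpM2l (ltW t0)); lra.
have k3 : t ^+ 3 * (w1 * su1) <= t ^+ 2 * su1 * m.
  have p : 0 <= t ^+ 2 * su1 by rewrite mulr_ge0 // exprn_ge0 // ltW.
  by have := ler_wpM2l p B3; lra.
have k4 : t ^+ 3 * (m * suw1) <= t * m ^+ 2.
  have := ler_wpM2l (mulr_ge0 (ltW t0) (ltW m0)) (le_trans (ler_wpM2l (ltW t0) B5) B4).
  by lra.
have k5 : t ^+ 3 * D <= 2 * tau * m ^+ 2.
  have h := ler_wpM2l (exprn_ge0 2 (ltW t0)) T.
  have h1 : t ^+ 2 * (tau^-1 * W1) <= tau * m ^+ 2.
    have -> : t ^+ 2 * (tau^-1 * W1) = tau * (t * W1).
      by rewrite tE; field; rewrite gt_eqF.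
    rewrite ler_pM2l //.
    have := ler_wpM2l (ltW t0) wS1; have := ler_wpM2l (ltW m0) B1; lra.
  have h2 : t ^+ 2 * (tau * W2) <= tau * m ^+ 2.
    have -> : t ^+ 2 * (tau * W2) = tau * (t ^+ 2 * W2) by ring.
    rewrite ler_pM2l //.
    have := ler_pM (mulr_ge0 (ltW t0) w10) (mulr_ge0 (ltW t0) sw10) B3 B4.
    have := ler_wpM2l (exprn_ge0 2 (ltW t0)) wS2; lra.
  lra.
have k6 : t * m ^+ 2 <= tau * m ^+ 2 by rewrite ler_wpM2r // sqr_ge0.
lra.
Qed.

(** Divided by [|M S|], each summand is at most [t^2 |m_u m_v - m_uv|], because [t |m_u|] and
    [t |m_v|] are at least [a]; [sum_pair_defect_le] bounds the total by 1. *)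
Lemma sum_correlation_le (S : {fset V}) (u : V) (F : seq V) : 0 <= a ->
  u \in S -> uniq F -> {subset F <= S `\ u} ->
  (forall v, v \in u :: F -> a * N (M S) <= t * N (M (S `\ v))) ->
  \sum_(v <- F) (a ^+ 2 * N (M S) - t ^+ 2 * N (M (S `\ u `\ v))) <= N (M S).
Proof.
move=> a0 uS uF FS am; have m0 := normc_matching_gt0 adjC th t0 S.
rewrite -(ler_pM2r m0) -expr2.
have B1 := normc_matchingD1 adjC th t0 uS.
have h := sum_pair_defect_le adjC th t0 uS; have w := weight_le adj th t S u.
have {w}h := ler_wpM2l (ltW t0) (le_trans h w).
apply: (@le_trans _ _ (t * (N (M S) * N (M (S `\ u))))); last first.
  have := ler_wpM2l (ltW m0) B1; lra.
apply: le_trans h.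
set PD := fun v => N (pair_defect adj (th +i* t)%C S u v).
apply: (@le_trans _ _ (t ^+ 2 * \sum_(v <- F) PD v)).
  rewrite mulr_suml mulr_sumr big_seq [leRHS]big_seq; apply: ler_sum => v vF.
  have au := am u (mem_head _ _); have av : a * N (M S) <= t * N (M (S `\ v)).
    by apply: am; rewrite inE vF orbT.
  have : N (M (S `\ u)) * N (M (S `\ v)) <= PD v + N (M S) * N (M (S `\ u `\ v)).
    rewrite -!normcM; set x := M (S `\ u) * _.
    have -> : x = pair_defect adj (th +i* t)%C S u v + M S * M (S `\ u `\ v).
      by rewrite /x /pair_defect; ring.
    exact: normcD.
  move/(ler_wpM2l (exprn_ge0 2 (ltW t0))).
  have := ler_pM (mulr_ge0 a0 (ltW m0)) (mulr_ge0 a0 (ltW m0)) au av; lra.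
have PD0 v : 0 <= PD v by exact: normc_ge0.
have : \sum_(v <- F) PD v <= \sum_(v <- S `\ u) PD v.
  have -> : \sum_(v <- F) PD v = \sum_(v <- S `\ u | v \in F) PD v.
    rewrite -[RHS]big_filter; apply: perm_big; apply: uniq_perm => //.
      by rewrite filter_uniq // fset_uniq.
    by move=> v; rewrite mem_filter; case vF: (v \in F) => //=; rewrite FS.
  by rewrite [leRHS](bigID (mem F)) /= lerDl sumr_ge0.
move/(ler_wpM2l (exprn_ge0 2 (ltW t0))).
have := mulr_ge0 (exprn_ge0 2 (ltW t0)) (sqr_ge0 (N (M (S `\ u)))); lra.
Qed.

End FixedHeight.

Local Notation M t := (matching_poly adj (th +i* t)%C).
Hypothesis (a0 : 0 < a) (adjI : forall x, ~~ adj x x).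

(** [t |m_v|] is the finite-volume counterpart of the mass of an atom at [th]. The bound is asked
    only on [K], since vertices near the boundary of [S] are not controlled. *)
Definition thick (K : seq V) (t : R) (S : {fset V}) : Prop :=
  {subset K <= S} /\ {in K, forall v, a * N (M t S) <= t * N (M t (S `\ v))}.

Lemma thick_sub (K K' : seq V) (t : R) (S : {fset V}) :
  {subset K' <= K} -> thick K t S -> thick K' t S.
Proof. by move=> KK [h1 h2]; split=> v /KK; [exact: h1|exact: h2]. Qed.

(** Induction along the walk by [chain_step]. [C] and [K] are independent of [tau] and [S], so [tau]
    can be made small afterwards. *)
Lemma decorrelation_path (u : V) (s : seq V) : path adj u s -> exists (C : R) (K : seq V), 0 <= C /\
  forall tau S, 0 < tau <= 1 -> thick K (tau ^+ 2) S -> u != last u s ->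
  (tau ^+ 2) ^+ 2 * N (M (tau ^+ 2) (S `\ u `\ last u s)) <= C * tau * N (M (tau ^+ 2) S).
Proof.
elim/last_ind: s => [_|s w IH].
  by exists 0, [::]; split=> // tau S _ _; rewrite eqxx.
rewrite rcons_path last_rcons => /andP[/IH[C [K [C0 H]]] {IH}].
set x := last u s in H * => xw.
(* The [1] pays for a last step leaving [u] itself, [(C + 4) / a] for a use of [chain_step]. *)
exists (1 + (C + 4) / a), [:: x, w, u & K]; split.
  by apply: addr_ge0 => //; apply: divr_ge0; [lra|exact: ltW].
move=> tau S tau01 th' uw; have /andP[tau0 tau1] := tau01.
have t0 : 0 < tau ^+ 2 by rewrite exprn_gt0.
have [sub thk] := th'.
have xS : x \in S by rewrite sub // !inE eqxx.
have wS : w \in S by rewrite sub // !inE eqxx orbT.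
have uS : u \in S by rewrite sub // !inE eqxx !orbT.
have m0 := normc_matching_gt0 adjC th t0 S.
have Ca : 0 <= (C + 4) / a by apply: divr_ge0; [lra|exact: ltW].
(* The walk may stand at [u] before its last step, at the start or by returning; the induction
   hypothesis is then void and adjacency suffices. *)
have [xu|xu] := eqVneq x u.
  rewrite xu in xw.
  have wSu : w \in S `\ u by rewrite !inE eq_sym uw.
  have h := normc_matching_adj adjC th t0 uS wSu xw.
  have := ler_wpM2l (ltW t0) h.
  have : tau ^+ 2 * N (M (tau ^+ 2) S) <= tau * N (M (tau ^+ 2) S) by rewrite ler_pM2r //; nra.
  have := mulr_ge0 (mulr_ge0 Ca (ltW tau0)) (ltW m0).
  lra.
have [xw'|xw'] := eqVneq x w.
  by move: xw; rewrite xw' (negPf (adjI w)).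
have h := chain_step t0 erefl tau01 xS uS wS xu xw' uw xw (thk x (mem_head _ _)).
have h2 : (tau ^+ 2) ^+ 2 * N (M (tau ^+ 2) (S `\ u `\ x)) <= C * tau * N (M (tau ^+ 2) S).
  apply: H => //; last by rewrite eq_sym.
  by apply: thick_sub th' => v vK; rewrite !inE vK !orbT.
rewrite -(ler_pM2l a0).
have -> : a * ((1 + (C + 4) / a) * tau * N (M (tau ^+ 2) S)) =
   a * (tau * N (M (tau ^+ 2) S)) + (C + 4) * tau * N (M (tau ^+ 2) S).
  by field; rewrite gt_eqF.
have := mulr_ge0 (ltW a0) (mulr_ge0 (ltW tau0) (ltW m0)).
lra.
Qed.

Hypothesis adj_conn : connected_graph adj.

Lemma decorrelation (u : V) (F : seq V) : exists (C : R) (K : seq V), 0 <= C /\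
  forall tau S, 0 < tau <= 1 -> thick K (tau ^+ 2) S -> {in F, forall v, u != v ->
  (tau ^+ 2) ^+ 2 * N (M (tau ^+ 2) (S `\ u `\ v)) <= C * tau * N (M (tau ^+ 2) S)}.
Proof.
elim: F => [|v F [C [K [C0 H]]]]; first by exists 0, [::].
have [s [ps lst]] := adj_conn u v.
have [C' [K' [C0' H']]] := decorrelation_path ps; rewrite lst in H'.
exists (C + C'), (K ++ K'); split; first exact: addr_ge0.
move=> tau S tau01 thk x; have /andP[tau0 _] := tau01.
have m0 : 0 <= N (M (tau ^+ 2) S) by exact: normc_ge0.
have e0 := mulr_ge0 (mulr_ge0 C0 (ltW tau0)) m0.
have e1 := mulr_ge0 (mulr_ge0 C0' (ltW tau0)) m0.
rewrite inE => /orP[/eqP->|xF] ux.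
  have := H' _ _ tau01 (thick_sub _ thk) ux; suff sub : {subset K' <= K ++ K'} by move/(_ sub); lra.
  by move=> y yK; rewrite mem_cat yK orbT.
have := H _ _ tau01 (thick_sub _ thk) x xF ux; suff sub : {subset K <= K ++ K'} by move/(_ sub); lra.
by move=> y yK; rewrite mem_cat yK.
Qed.

End FiniteGraphBounds.

(** * Impossibility of thick windows in an infinite graph *)

Lemma infinite_set_uniq_seq (V : choiceType) (n : nat) (u : V) : infinite_set [set: V] ->
  exists F : seq V, [/\ uniq F, size F = n & u \notin F].
Proof.
move=> infV; suff [F [uF sF]] : exists F : seq V, uniq F /\ size F = n.+1.
  have [uin|unin] := boolP (u \in F).
    by exists (rem u F); rewrite rem_uniq // size_rem // sF mem_rem_uniq // inE eqxx.
  by exists (behead F); case: F uF sF unin => //= x F /andP[_ ->] [->]; rewrite inE negb_or => /andP[].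
elim: n.+1 => [|k [F [uF sF]]]; first by exists [::].
have [x xF] : exists x, x \notin F.
  apply: contrapT => h; apply: infV; apply: (@sub_finite_set _ _ [set` F]) => //.
  by move=> x _ /=; apply: contrapT => /negP xF; apply: h; exists x.
by exists (x :: F); rewrite /= xF uF sF.
Qed.

Lemma no_thick (V : choiceType) (adj : rel V) (R : realType) (th a : R) (o : V) :
  simple_graph adj -> infinite_set [set: V] -> connected_graph adj -> 0 < a ->
  ~ (forall (K : seq V) (t : R), 0 < t -> exists S, thick adj th a K t S).
Proof.
move=> [adjC adjI] infV conn a0 H.
(* With [n a^2 > 2] and, by the later choice of [tau], [n C tau < 1], the sum over [F] exceeds the
   bound 1 of [sum_correlation_le]. *)
pose n := (Num.truncn (2 / a ^+ 2)).+1.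
have na : 2 < n%:R * a ^+ 2.
  rewrite -ltr_pdivrMr ?exprn_gt0 //; exact: truncnS_gt.
have [F [uF sF oF]] := infinite_set_uniq_seq n o infV.
have [C [K [C0 HC]]] := decorrelation adjC th a0 adjI conn o F.
pose tau := (n%:R * C + 1)^-1.
have nC : 0 <= n%:R * C by rewrite mulr_ge0.
have tau0 : 0 < tau by rewrite invr_gt0; lra.
have tauE : tau * (n%:R * C + 1) = 1 by rewrite mulVf // gt_eqF //; lra.
have tau1 : tau <= 1 by nra.
have t0 : 0 < tau ^+ 2 by rewrite exprn_gt0.
have [S thk] := H (o :: F ++ K) _ t0.
have [sub am] := thk.
have oS : o \in S by apply: sub; rewrite mem_head.
have FS : {subset F <= S `\ o}.
  move=> v vF; rewrite !inE sub ?inE ?mem_cat ?vF ?orbT // andbT.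
  by apply: contraNneq oF => <-.
have amF v : v \in o :: F -> a * normc (matching_poly adj (th +i* tau ^+ 2)%C S) <=
    tau ^+ 2 * normc (matching_poly adj (th +i* tau ^+ 2)%C (S `\ v)).
  by move=> vF; apply: am; move: vF; rewrite !inE mem_cat => /orP[->|->]; rewrite ?orbT.
have h := sum_correlation_le adjC t0 (ltW a0) oS uF FS amF.
have m0 := normc_matching_gt0 adjC th t0 S.
set m := normc (matching_poly adj (th +i* tau ^+ 2)%C S) in h m0.
have : \sum_(v <- F) (a ^+ 2 * m - C * tau * m) <= m.
  apply: le_trans h; rewrite big_seq [leRHS]big_seq; apply: ler_sum => v vF.
  rewrite lerD2l lerN2; apply: (HC tau S) => //; first by rewrite tau0.
    by apply: thick_sub thk => x xK; rewrite inE mem_cat xK !orbT.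
  by apply: contraNneq oF => ->.
rewrite big_const_seq count_predT sF iter_addr_0 -[X in X <= _]mulr_natr.
have -> : (a ^+ 2 * m - C * tau * m) * n%:R = (n%:R * a ^+ 2 - n%:R * C * tau) * m by ring.
rewrite -{2}[m]mul1r ler_pM2r //.
by have : n%:R * C * tau < 1; lra.
Qed.

(** * Paths inside a finite set as vertices of the path tree *)

Section PathsInFiniteSet.
Variables (V : choiceType) (adj : rel V).

(** Deleting [u] before recursing mirrors the recurrences for [M] and [weight]. *)
Fixpoint paths_in (n : nat) (u : V) (S : {fset V}) : seq (seq V) :=
  if n is n'.+1 then
    [::] :: [seq x :: s | x <- [seq x <- S `\ u | adj u x], s <- paths_in n' x (S `\ u)]
  else [:: [::]].

Lemma mem_paths_in n u (S : {fset V}) s : u \in S ->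
  (s \in paths_in n u S) = [&& (size s <= n)%N, path adj u s, uniq (u :: s) & all (mem S) s].
Proof.
elim: n u S s => [|n IH] u S s uS /=; first by case: s => [|x s]; rewrite inE.
rewrite in_cons; case: s => [|x s] //=.
have -> : (x :: s \in [seq x0 :: s0 | x0 <- [seq x0 <- S `\ u | adj u x0],
    s0 <- paths_in n x0 (S `\ u)]) =
    [&& adj u x, x \in S `\ u & s \in paths_in n x (S `\ u)].
  apply/allpairsPdep/and3P => [[y [q [yS qp [-> ->]]]]|[ux xS sp]].
    by move: yS; rewrite mem_filter => /andP[].
  by exists x, s; rewrite mem_filter ux.
have [xS|] := boolP (x \in S `\ u); last first.
  by rewrite !inE negb_and negbK => /orP[/eqP->|/negPf->]; rewrite ?eqxx /= ?andbF.
rewrite IH //; move: xS; rewrite !inE => /andP[xu ->] /=.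
have -> : all (mem (S `\ u)) s = (u \notin s) && all (mem S) s.
  elim: s => //= y s ->; rewrite !inE negb_or (eq_sym y).
  by case: (u != y); case: (u \notin s); rewrite //= andbF.
rewrite negb_or (eq_sym u) xu /=.
by case: (adj u x); case: (u \notin s); rewrite ?andbF.
Qed.

Lemma uniq_paths_in n u (S : {fset V}) : uniq (paths_in n u S).
Proof.
elim: n u S => //= n IH u S; apply/andP; split.
  by apply/negP => /allpairsPdep[x [s []]].
apply: allpairs_uniq_dep => [|x _|]; rewrite ?filter_uniq ?fset_uniq //.
by move=> [x s] [y q] _ _ [] /= <- <-.
Qed.

Definition del_seq (S : {fset V}) (s : seq V) : {fset V} := foldl (fun T x => T `\ x) S s.

Lemma mem_del_seq S s x : (x \in del_seq S s) = (x \in S) && (x \notin s).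
Proof. by elim: s S => [|y s IH] S /=; rewrite ?andbT // IH !inE negb_or andbA (andbC (x != y)). Qed.

Lemma del_seq_rcons S s x : del_seq S (rcons s x) = del_seq S s `\ x.
Proof. by rewrite /del_seq -cats1 foldl_cat. Qed.

Definition tree_adj (u : V) (s p : seq V) : bool := `[< path_tree_adj adj u s p >].

Lemma tree_adjC u s p : tree_adj u s p = tree_adj u p s.
Proof. by apply/asboolP/asboolP => -[? [? []]]; do !split => //; [right|left|right|left]. Qed.

(** Parent first, then children. Depth [n.+1] on the left keeps the children of a path of length
    [n]. *)
Lemma perm_tree_nbhd n u (S : {fset V}) s : u \in S -> s \in paths_in n u S ->
  perm_eq [seq p <- paths_in n.+1 u S | tree_adj u s p]
   ((if s == [::] then [::] else [:: take (size s).-1 s]) ++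
    [seq rcons s x | x <- [seq x <- del_seq (S `\ u) s | adj (last u s) x]]).
Proof.
move=> uS sP; apply: uniq_perm.
- by rewrite filter_uniq // uniq_paths_in.
- rewrite cat_uniq; apply/and3P; split; first by case: ifP.
    apply/hasPn => _ /mapP[x _ ->]; case: ifP => // _; rewrite inE.
    apply/negP => /eqP/(congr1 size); rewrite size_rcons size_take; case: ifP; lia.
  by rewrite map_inj_uniq ?filter_uniq ?fset_uniq //; exact: rcons_injr.
move: sP; rewrite mem_paths_in // => /and4P[sn ps us sS] p.
rewrite mem_filter mem_paths_in // mem_cat; apply/andP/orP.
- case=> /asboolP[_ [_ [[x ->]|[x sE]]]] /and4P[_ pp up pS]; last first.
    left; rewrite sE size_rcons /= -cats1 take_size_cat //.
    case: eqP => [/(congr1 size)|_]; last by rewrite inE.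
    by rewrite size_cat addn1.
  right; apply/mapP; exists x => //; rewrite mem_filter mem_del_seq.
  move: pp up pS; rewrite rcons_path all_rcons => /andP[_ ->] /=.
  rewrite mem_rcons rcons_uniq !inE negb_or (eq_sym x) => /andP[/andP[-> _] /andP[-> _]].
  by move=> /andP[-> _].
- case.
    case: eqP => // s0; rewrite inE => /eqP pE.
    case/lastP: s => [|s x] // in s0 sn ps us sS pE *.
    move: pE; rewrite size_rcons /= -cats1 take_size_cat // cats1 => ->.
    have ps' : path adj u s by move: ps; rewrite rcons_path => /andP[].
    have us' : uniq (u :: s).
      by move: us; rewrite -rcons_cons rcons_uniq => /andP[].
    split.
      by apply/asboolP; split=> //; split=> //; right; exists x.
    apply/and4P; split=> //; first by move: sn; rewrite size_rcons => /ltnW/leqW.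
    by move: sS; rewrite all_rcons => /andP[].
  case/mapP => x; rewrite mem_filter mem_del_seq !inE => /andP[ax /andP[/andP[xu xS] xs]] ->.
  have pp : path adj u (rcons s x) by rewrite rcons_path ps.
  have up : uniq (u :: rcons s x).
    by rewrite -rcons_cons rcons_uniq us inE negb_or xu xs.
  split; first by apply/asboolP; split=> //; split=> //; left; exists x.
  by apply/and4P; split=> //; rewrite ?size_rcons ?ltnS // all_rcons sS andbT.
Qed.

End PathsInFiniteSet.

(** * The resolvent equation on the path tree and its square-sum bound *)

Section Pathwise.
Variables (V : choiceType) (adj : rel V) (adjC : symmetric adj).

(** This is the recurrence of [M] at the last vertex of the path: the parent is the set before that
    vertex is deleted, the children are the further deletions. The root has no parent, which leaves
    the source term [M S]. *)
Lemma sum_tree_nbhd (K : comNzRingType) (z : K) n u (S : {fset V}) s :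
  u \in S -> s \in paths_in adj n u S ->
  \sum_(p <- paths_in adj n.+1 u S | tree_adj adj u s p) matching_poly adj z (del_seq (S `\ u) p)
  = z * matching_poly adj z (del_seq (S `\ u) s)
    - (if s == [::] then matching_poly adj z S else 0).
Proof.
move=> uS sP; rewrite -big_filter (perm_big _ (perm_tree_nbhd uS sP)) big_cat /= big_map big_filter.
under [X in _ + X]eq_bigr do rewrite del_seq_rcons.
move: sP; rewrite mem_paths_in // => /and4P[_ _ us sS].
case/lastP: s us sS => [|s x] us sS.
  by rewrite eqxx big_nil (matching_polyD1 z adjC uS) /=; ring.
have -> : (rcons s x == [::]) = false by case: (s).
rewrite size_rcons /= big_seq1 -{1}cats1 take_size_cat // last_rcons.
have xS : x \in del_seq (S `\ u) s.
  move: us sS; rewrite mem_del_seq -rcons_cons rcons_uniq all_rcons !inE negb_or.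
  by case/andP=> /andP[-> ->] _ /andP[-> _].
by rewrite (matching_polyD1 z adjC xS) del_seq_rcons; ring.
Qed.

Lemma sum_paths_le (R : rcfType) (th t : R) n u (S : {fset V}) : 0 < t -> u \in S ->
  t * \sum_(p <- paths_in adj n u S)
    normc (matching_poly adj (th +i* t)%C (del_seq (S `\ u) p)) ^+ 2 <= weight adj th t S u.
Proof.
move=> t0; elim: n u S => [|n IH] u S uS /=; first by rewrite big_seq1; exact: weight_ge.
rewrite big_cons big_allpairs_dep /= mulrDr weightD1 // lerD2l big_filter mulr_sumr.
rewrite big_seq_cond [leRHS]big_seq_cond; apply: ler_sum => v /andP[vS _].
exact: IH.
Qed.

End Pathwise.

(** * Linear functionals on polynomials *)

Section LinearForm.
Variable R : comNzRingType.
Implicit Types (f : nat -> R) (p q : {poly R}).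

(** The linear extension of ['X^n |-> f n]: integration when [f] is a moment sequence, evaluation of
    [p(A) chi] at a path when [f] lists the iterates there. *)
Definition linform f p : R := \sum_(i < size p) p`_i * f i.

Lemma linformE k f p : (size p <= k)%N -> linform f p = \sum_(i < k) p`_i * f i.
Proof.
move=> pk; rewrite /linform (big_ord_widen k (fun i => p`_i * f i) pk) big_mkcond /=.
by apply: eq_bigr => i _; case: ltnP => // h; rewrite nth_default ?mul0r.
Qed.

Lemma linformD f p q : linform f (p + q) = linform f p + linform f q.
Proof.
rewrite !(@linformE (maxn (size p) (size q))) ?leq_maxl ?leq_maxr ?size_polyD //.
by rewrite -big_split /=; apply: eq_bigr => i _; rewrite coefD mulrDl.
Qed.

Lemma linformZ f c p : linform f (c *: p) = c * linform f p.
Proof.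
rewrite !(@linformE (size p)) ?size_scale_leq // mulr_sumr.
by apply: eq_bigr => i _; rewrite coefZ mulrA.
Qed.

Lemma linformN f p : linform f (- p) = - linform f p.
Proof. by rewrite -scaleN1r linformZ mulN1r. Qed.

Lemma linform_sum f (I : Type) (s : seq I) (P : pred I) (F : I -> {poly R}) :
  linform f (\sum_(i <- s | P i) F i) = \sum_(i <- s | P i) linform f (F i).
Proof.
elim/big_rec2: _ => [|i a b _ <-]; last exact: linformD.
by rewrite /linform size_poly0 big_ord0.
Qed.

Lemma linformXn f n : linform f 'X^n = f n.
Proof.
rewrite /linform size_polyXn big_ord_recr /= coefXn eqxx mul1r big1 ?add0r // => i _.
by rewrite coefXn ltn_eqF ?mul0r.
Qed.

Lemma linformMX f p : linform f (p * 'X) = linform (fun i => f i.+1) p.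
Proof.
rewrite (@linformE (size p).+1) ?(leq_trans (size_polyMleq _ _)) ?size_polyX ?addn2 //.
by rewrite big_ord_recl coefMX mul0r add0r; apply: eq_bigr => i _; rewrite coefMX.
Qed.

Lemma linformM f p q :
  linform f (p * q) = \sum_(i < size p) \sum_(j < size q) p`_i * q`_j * f (i + j)%N.
Proof.
rewrite -{1}(coefK p) -{1}(coefK q) !poly_def mulr_suml linform_sum.
apply: eq_bigr => i _; rewrite mulr_sumr linform_sum; apply: eq_bigr => j _.
by rewrite -scalerAr -scalerAl scalerA -exprD linformZ linformXn; ring.
Qed.

End LinearForm.

(** * The path tree operator on a window containing a ball *)

Section PathTreeOperator.
Variables (V : choiceType) (adj : rel V) (R : realType) (u : V) (N : nat) (S : {fset V}).
Hypothesis S_deep : forall s, is_path_from adj u s -> (size s <= N)%N -> {subset u :: s <= S}.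
Local Notation A := (@path_tree_op R V adj u).
Local Notation L := (paths_in adj N u S).

Lemma root_in_deep : u \in S.
Proof. by apply: (S_deep (s := [::])) => //; rewrite mem_head. Qed.

Lemma mem_paths_deep n s : (n <= N)%N ->
  s \in paths_in adj n u S = (size s <= n)%N && `[< is_path_from adj u s >].
Proof.
move=> nN; rewrite (mem_paths_in _ _ _ root_in_deep); case: leqP => //= sn.
apply/and3P/asboolP => [[]//|[ps us]]; split=> //.
apply/allP => x xs; apply: (S_deep (s := s)) => //; first exact: leq_trans nN.
by rewrite inE xs orbT.
Qed.

Definition supported_le (n : nat) (h : seq V -> R) :=
  forall s, h s != 0 -> is_path_from adj u s /\ (size s <= n)%N.

(** By [S_deep], paths of length at most [N] from [u] are the same in [S] as in the whole graph, so
    the finite-support sum in [A] runs over [L]. *)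
Lemma path_tree_opE h s : supported_le N h -> A h s = \sum_(p <- L | tree_adj adj u s p) h p.
Proof.
move=> sup; rewrite bigfs ?uniq_paths_in //; last first.
  move=> p _; rewrite mem_paths_deep // => pL; apply/eqP; apply: contraNT pL => /sup[pp ->].
  exact/asboolP.
by apply: eq_fsbigl; apply/seteqP; split=> p /asboolP.
Qed.

Lemma supported_le_op n h : supported_le n h -> supported_le n.+1 (A h).
Proof.
move=> sup s As; have [p [ps [_ st]] /sup[_ pn]] :
    exists2 p, path_tree_adj adj u s p & h p != 0.
  apply: contrapT => no; move: As; rewrite /path_tree_op fsbig1 ?eqxx // => p sp.
  by apply/eqP; apply: contrapT => /negP hp; apply: no; exists p.
split=> //.
by case: st => -[x E]; move: pn; rewrite E size_rcons ?ltnS //; lia.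
Qed.

Local Notation chi := (@root_indicator R V).

Lemma supported_le_iter i : supported_le i (iter i A chi).
Proof.
elim: i => [|i IH] /=; last exact: supported_le_op.
by move=> s; rewrite /root_indicator; case: (s =P [::]) => [->|_] //; rewrite eqxx.
Qed.

Lemma supported_leW n m h : (n <= m)%N -> supported_le n h -> supported_le m h.
Proof. by move=> nm sup s /sup[? h1]; split=> //; exact: leq_trans nm. Qed.

Lemma path_tree_op_sym h k : supported_le N h -> supported_le N k ->
  \sum_(s <- L) A h s * k s = \sum_(s <- L) h s * A k s.
Proof.
move=> sh sk.
under eq_bigr do rewrite path_tree_opE // mulr_suml big_mkcond /=.
rewrite exchange_big /=; apply: eq_bigr => s _; rewrite path_tree_opE // mulr_sumr.
by rewrite [RHS]big_mkcond /=; apply: eq_bigr => p _; rewrite tree_adjC.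
Qed.

Lemma nil_in_paths n : [::] \in paths_in adj n u S.
Proof. by rewrite mem_paths_in // root_in_deep. Qed.

(** Self-adjointness moves one power of [A] at a time; [i + j <= N] keeps every iterate inside the
    window. *)
Lemma sum_iter_mul i j : (i + j <= N)%N ->
  \sum_(s <- L) iter i A chi s * iter j A chi s = path_tree_moment R adj u (i + j).
Proof.
elim: j i => [|j IH] i ij /=.
  rewrite (bigD1_seq [::]) ?nil_in_paths ?uniq_paths_in //= {2}/root_indicator eqxx mulr1 addn0.
  by rewrite big1 ?addr0 // => s /negPf s0; rewrite /root_indicator s0 mulr0.
rewrite -path_tree_op_sym ?addnS -?addSn.
- by apply: (IH i.+1); lia.
- by apply: (supported_leW _ (@supported_le_iter i)); lia.
- by apply: (supported_leW _ (@supported_le_iter j)); lia.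
Qed.

(** The vector [p(A) chi]. *)
Definition poly_vector (p : {poly R}) (s : seq V) : R := linform (fun i => iter i A chi s) p.

Lemma sum_poly_vector_mul (p q : {poly R}) : (size p + size q <= N)%N ->
  \sum_(s <- L) poly_vector p s * poly_vector q s = linform (path_tree_moment R adj u) (p * q).
Proof.
move=> pq; rewrite linformM.
under eq_bigr do rewrite mulr_suml.
rewrite exchange_big /=; apply: eq_bigr => i _.
under eq_bigr do rewrite mulr_sumr.
rewrite exchange_big /=; apply: eq_bigr => j _.
rewrite -sum_iter_mul; last by apply: leq_trans pq; apply: leq_add; exact: ltnW.
by rewrite mulr_sumr; apply: eq_bigr => s _; ring.
Qed.

End PathTreeOperator.

(** * Lower bound on the resolvent at the root *)

Section ResolventMass.
Variables (V : choiceType) (adj : rel V) (adjC : symmetric adj).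
Variables (R : realType) (th t : R) (t0 : 0 < t) (u : V) (n : nat) (S : {fset V}).
Hypothesis S_deep : forall s, is_path_from adj u s -> (size s <= n.+1)%N -> {subset u :: s <= S}.
Local Notation A := (@path_tree_op R V adj u).
Local Notation chi := (@root_indicator R V).
Local Notation L := (paths_in adj n.+1 u S).
Local Notation M := (matching_poly adj (th +i* t)%C).

(** The root column of [(z - A)^-1] for the path tree of the graph induced on [S]. *)
Definition green (s : seq V) : R[i] := M (del_seq (S `\ u) s) / M S.

Lemma sum_green_nbhd s : s \in paths_in adj n u S ->
  \sum_(p <- L | tree_adj adj u s p) green p = (th +i* t)%C * green s - (s == [::])%:R.
Proof.
move=> sP; rewrite /green -mulr_suml (sum_tree_nbhd adjC _ (root_in_deep S_deep) sP).
have M0 : M S != 0.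
  apply/eqP => E; have := normc_matching_gt0 adjC th t0 S.
  by rewrite E normc0 ltxx.
by case: (s == [::]) => /=; field.
Qed.

Lemma Re_sum (I : Type) (r : seq I) (P : pred I) (F : I -> R[i]) :
  Re (\sum_(i <- r | P i) F i) = \sum_(i <- r | P i) Re (F i).
Proof. by elim/big_rec2: _ => //= i a b _ <-; case: (F i) b => [c d] [e f]. Qed.

(** Real part of [<(z - A) green, v> = v root] for [v = A^i chi], with [A] moved onto [v]. As
    [i <= n], [v] vanishes on the outermost layer, where the equation is cut off. *)
Lemma sum_green_iter i : (i <= n)%N ->
  \sum_(s <- L) (Re (green s) * (th * iter i A chi s - iter i.+1 A chi s)
                 - t * Im (green s) * iter i A chi s) = iter i A chi [::].
Proof.
move=> iN; set v := iter i A chi.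
have sv : supported_le adj u n v by apply: (supported_leW _ (@supported_le_iter _ _ _ _ i)).
have sv' : supported_le adj u n.+1 v by apply: (supported_leW _ sv).
have -> : \sum_(s <- L) (Re (green s) * (th * v s - iter i.+1 A chi s)
     - t * Im (green s) * v s) =
  \sum_(s <- L) v s * (Re ((th +i* t)%C * green s)
     - \sum_(p <- L | tree_adj adj u s p) Re (green p)).
  transitivity (\sum_(s <- L) v s * Re ((th +i* t)%C * green s)
      - \sum_(s <- L) iter i.+1 A chi s * Re (green s)).
    rewrite -sumrB; apply: eq_bigr => s _; case: (green s) => a b /=; ring.
  transitivity (\sum_(s <- L) v s * Re ((th +i* t)%C * green s)
      - \sum_(s <- L) v s * \sum_(p <- L | tree_adj adj u s p) Re (green p)); last first.
    by rewrite -sumrB; apply: eq_bigr => s _; rewrite mulrBr.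
  congr (_ - _); rewrite [iter i.+1 _ _]/= -/v.
  under eq_bigr do rewrite (path_tree_opE S_deep) // mulr_suml big_mkcond /=.
  rewrite exchange_big /=; apply: eq_bigr => s _; rewrite mulr_sumr.
  by rewrite [RHS]big_mkcond /=; apply: eq_bigr => p _; rewrite tree_adjC.
rewrite (bigD1_seq [::]) ?uniq_paths_in ?(nil_in_paths S_deep) // -[LHS]/(_ + _) addrC big1_seq ?add0r.
  rewrite -Re_sum sum_green_nbhd ?(nil_in_paths S_deep) // eqxx.
  by case: ((th +i* t)%C * green [::]) => a b /=; ring.
move=> s /andP[s0 _]; have [->|/sv[ps sn]] := eqVneq (v s) 0; first by rewrite mul0r.
rewrite -Re_sum sum_green_nbhd ?(negPf s0) ?subr0 ?subrr ?mulr0 //.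
by rewrite (mem_paths_deep S_deep) // sn; apply/asboolP.
Qed.

Lemma sum_green_poly (p : {poly R}) : (size p <= n)%N ->
  \sum_(s <- L) (Re (green s) * poly_vector adj u ((th%:P - 'X) * p) s
                 - t * Im (green s) * poly_vector adj u p s) = poly_vector adj u p [::].
Proof.
move=> pn; transitivity (\sum_(i < size p) p`_i * \sum_(s <- L)
    (Re (green s) * (th * iter i A chi s - iter i.+1 A chi s)
     - t * Im (green s) * iter i A chi s)); last first.
  by apply: eq_bigr => i _; rewrite sum_green_iter // (leq_trans _ pn) // ltnW.
under [RHS]eq_bigr do rewrite mulr_sumr.
rewrite exchange_big /=; apply: eq_bigr => s _.
rewrite /poly_vector mulrBl linformD linformN mul_polyC linformZ (mulrC 'X) linformMX.
rewrite /linform mulr_sumr -sumrB !mulr_sumr -sumrB.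
by apply: eq_bigr => i _ /=; ring.
Qed.

(** [sum_green_poly] pairs [green] with [a = (th - A) p(A) chi] and [b = p(A) chi]. AM-GM gives [4
    t^2 linform m p <= 4 t^4 |green|^2 + |a|^2 + t^2 |b|^2]; by hypothesis the last two terms take
    at most half of the left side, and [|green|^2 <= |M (S - u) / M S| / t]. *)
Lemma resolvent_mass (p : {poly R}) : (size p + size p + 4 <= n)%N ->
  let m := path_tree_moment R adj u in
  linform m ((th%:P - 'X) ^+ 2 * p ^+ 2) + t ^+ 2 * linform m (p ^+ 2)
    <= 2 * t ^+ 2 * linform m p ->
  linform m p / 2 * normc (M S) <= t * normc (M (S `\ u)).
Proof.
move=> pn m H.
have uS := root_in_deep S_deep; have m0 := normc_matching_gt0 adjC th t0 S.
have sp : (size ((th%:P - 'X) * p)%R <= (size p).+1)%N.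
  apply: leq_trans (size_polyMleq _ _) _.
  by rewrite -opprB size_polyN size_XsubC.
have E1 := @sum_green_poly p ltac:(lia).
have E2 := sum_poly_vector_mul S_deep (p := p) (q := p) ltac:(lia).
have E3 := sum_poly_vector_mul S_deep (p := (th%:P - 'X) * p) (q := (th%:P - 'X) * p) ltac:(lia).
have E4 : linform m p = poly_vector adj u p [::] by [].
rewrite -expr2 exprMn in E3; rewrite -expr2 in E2.
have G := sum_paths_le adjC th n.+1 t0 uS.
have W := weight_le adj th t S u.
set a := poly_vector adj u ((th%:P - 'X) * p) in E1 E3.
set b := poly_vector adj u p in E1 E2 E4.
have t20 : 0 < t ^+ 2 by rewrite exprn_gt0.
have key : 4 * t ^+ 2 * linform m p <= \sum_(s <- L) (4 * t ^+ 4 * normc (green s) ^+ 2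
    + (a s * a s + t ^+ 2 * (b s * b s))).
  rewrite E4 -E1 mulr_sumr; apply: ler_sum => s _; rewrite sqr_normc.
  have := sqr_ge0 (2 * t ^+ 2 * Re (green s) - a s).
  have := sqr_ge0 (2 * t ^+ 2 * Im (green s) + t * b s).
  lra.
move: key; rewrite big_split /= big_split /= -!mulr_sumr E2 E3.
have -> : \sum_(s <- L) normc (green s) ^+ 2 =
    (\sum_(s <- L) normc (M (del_seq (S `\ u) s)) ^+ 2) / normc (M S) ^+ 2.
  by rewrite mulr_suml; apply: eq_bigr => s _; rewrite /green normcM normcV exprMn exprVn.
move=> key.
have {G W} G := le_trans G W.
have h : 2 * t ^+ 2 * linform m p <= 4 * t ^+ 3 * (normc (M (S `\ u)) / normc (M S)).
  have : t * \sum_(s <- L) normc (M (del_seq (S `\ u) s)) ^+ 2 / normc (M S) ^+ 2 <=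
      normc (M (S `\ u)) / normc (M S).
    rewrite -mulr_suml mulrA ler_pdivrMr ?exprn_gt0 //.
    apply: le_trans G _; rewrite le_eqVlt; apply/orP; left; apply/eqP.
    by field; rewrite gt_eqF.
  rewrite -mulr_suml => /(ler_wpM2l (exprn_ge0 3 (ltW t0))).
  move: H key; rewrite /m; lra.
have : linform m p / 2 <= t * (normc (M (S `\ u)) / normc (M S)).
  rewrite -(ler_pM2l t20); lra.
by move=> h'; rewrite -ler_pdivlMr // -mulrA.
Qed.

End ResolventMass.

(** * Integration of polynomials against the measure *)

Section PolynomialIntegrals.
Variables (R : realType) (nu : probability R R) (D : R) (m : nat -> R).
Local Notation B := (`[- D, D]%classic : set R).
Hypothesis nuB : nu B = 1%E.
Hypothesis mE : forall n, (\int[nu]_x (x ^+ n)%:E = (m n)%:E)%E.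

Let mB : measurable B. Proof. exact: measurable_itv. Qed.
Let nuCB : nu (~` B)%classic = 0%E.
Proof. by rewrite probability_setC // nuB subee. Qed.
Let BE : (setT `\` ~` B)%classic = B. Proof. by rewrite setTD setCK. Qed.

Lemma integrable_exprn n : nu.-integrable setT (fun x : R => (x ^+ n)%:E).
Proof.
apply/(@negligible_integrable _ _ _ _ _ (~` B)%classic) => //.
- exact: measurableC.
- by apply/measurable_EFinP; exact: exprn_measurable.
rewrite BE; apply: (@measurable_bounded_integrable _ _ _ _ (fun x : R => x ^+ n)) => //.
- exact: le_lt_trans (probability_le1 nu mB) (ltry 1).
exists (D ^+ n); split; first exact: num_real.
move=> M DM x; rewrite /= in_itv /= => /andP[x1 x2].
apply: le_trans (ltW DM); rewrite normrX; apply: lerXn2r; rewrite ?nnegrE //.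
  by have := le_trans x1 x2; lra.
by rewrite ler_norml x1.
Qed.

Lemma horner_EFin_sum (p : {poly R}) x :
  (p.[x])%:E = (\sum_(i < size p) (p`_i)%:E * (x ^+ i)%:E)%E.
Proof. by rewrite horner_coef -sumEFin. Qed.

Lemma integrable_horner (p : {poly R}) : nu.-integrable setT (fun x => (p.[x])%:E).
Proof.
rewrite (_ : (fun x => _) = fun x => (\sum_(i < size p) (p`_i)%:E * (x ^+ i)%:E)%E); last first.
  by apply/funext => x; rewrite horner_EFin_sum.
by apply: integrable_sum => // i _; apply: integrableZl => //; exact: integrable_exprn.
Qed.

Lemma integral_horner (p : {poly R}) : (\int[nu]_x (p.[x])%:E = (linform m p)%:E)%E.
Proof.
under eq_integral do rewrite horner_EFin_sum.
rewrite integral_sum // => [|i]; last by apply: integrableZl => //; exact: integrable_exprn.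
rewrite /linform -sumEFin; apply: eq_bigr => i _.
by rewrite integralZl ?mE //; exact: integrable_exprn.
Qed.

(** Restrict the integral to the atom. As [0 <= p.[th]], this also gives positivity of [linform m],
    used to compare polynomials on the interval. *)
Lemma linform_ge (p : {poly R}) (th : R) : th \in `[- D, D] ->
  (forall x, x \in `[- D, D] -> 0 <= p.[x]) -> fine (nu [set th]%classic) * p.[th] <= linform m p.
Proof.
move=> thB p0; rewrite -lee_fin -integral_horner.
rewrite (negligible_integral (measurableC mB)) ?integrable_horner //.
rewrite BE; apply: (@le_trans _ _ (\int[nu]_(x in [set th]%classic) (p.[x])%:E)%E).
  rewrite (@eq_integral _ _ _ _ _ (cst (p.[th])%:E)); last by move=> x /set_mem /= ->.
  by rewrite integral_cst // EFinM fineK ?fin_num_measure // muleC.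
apply: ge0_subset_integral => //.
- by have /integrableP[h _] := integrable_horner p; exact: measurable_funS h.
- by move=> x ->.
Qed.

End PolynomialIntegrals.

(** * Polynomials approximating the indicator of a point *)

Section PolynomialBump.
Variables (R : realType) (D th : R).

(* With [y = ((x - th) / (2D + 1))^2], which lies in [0, 1] for [x] in [[-D, D]], this is
   [(1 - y)^n]; it tends to the indicator of [th] on [[-D, D]]. *)
Definition bump (n : nat) : {poly R} := (1 - ((2 * D + 1) ^- 2)%:P * (th%:P - 'X) ^+ 2) ^+ n.

Lemma bernoulli_le (y : R) n : 0 <= y <= 1 -> n%:R * y * (1 - y) ^+ n <= 1.
Proof.
move=> /andP[y0 y1]; have z0 : 0 <= 1 - y by lra.
(* The stronger form is Bernoulli's [(1 + n y) (1 - y)^n <= 1], which passes through the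
   induction. *)
suff : n%:R * y * (1 - y) ^+ n <= 1 - (1 - y) ^+ n.
  by have := exprn_ge0 n z0; lra.
elim: n => [|n IH]; first by rewrite mul0r mul0r expr0 subrr.
have e0 := exprn_ge0 n z0.
have := ler_wpM2r z0 IH; rewrite exprSr -natr1.
have e1 : (1 - y) ^+ n <= 1 by rewrite exprn_ile1 //; lra.
move: e0 e1 IH; set e := (1 - y) ^+ n; move: (n%:R : R) => k e0 e1 _.
have w0 : 0 <= 1 - e * (1 - y) by have := mulr_ile1 e0 z0 e1; lra.
have := mulr_ge0 y0 w0; lra.
Qed.

Hypotheses (D0 : 0 <= D) (thB : th \in `[- D, D]).

Lemma bump_itv n x : x \in `[- D, D] ->
  exists y : R, [/\ 0 <= y <= 1, (th - x) ^+ 2 = (2 * D + 1) ^+ 2 * y & (bump n).[x] = (1 - y) ^+ n].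
Proof.
move: thB; rewrite !in_itv /= => /andP[t1 t2] /andP[x1 x2].
exists ((2 * D + 1) ^- 2 * (th - x) ^+ 2).
(* The [1] keeps the scale positive even when [D = 0]. *)
have d0 : 0 < (2 * D + 1) ^+ 2 by rewrite exprn_gt0 //; lra.
split; last by rewrite /bump !hornerE.
  rewrite mulr_ge0 ?sqr_ge0 ?invr_ge0 ?(ltW d0) //= mulrC ler_pdivrMr // mul1r; nra.
by rewrite mulrA divff ?mul1r // gt_eqF.
Qed.

End PolynomialBump.

(** On the interval the bump satisfies [p^2 <= p] and, by [bernoulli_le], [(th - x)^2 p^2 <= L / n].
    Taking [n] large makes the latter at most [t^2 c], and [c <= linform m p] since [p.[th] = 1]. *)
Lemma moment_bump_bound (R : realType) (nu : probability R R) (D th t : R) (m : nat -> R) :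
  nu `[- D, D]%classic = 1%E -> (forall n, (\int[nu]_x (x ^+ n)%:E = (m n)%:E)%E) ->
  0 <= D -> th \in `[- D, D] -> 0 < fine (nu [set th]%classic) -> 0 < t ->
  exists p : {poly R}, fine (nu [set th]%classic) <= linform m p /\
    linform m ((th%:P - 'X) ^+ 2 * p ^+ 2) + t ^+ 2 * linform m (p ^+ 2)
      <= 2 * t ^+ 2 * linform m p.
Proof.
move=> nuB mE D0 thB c0 t0; set c := fine _ in c0 *.
have LG := linform_ge nuB mE thB.
have c1 : 0 <= c by exact: ltW.
have t20 : 0 < t ^+ 2 by rewrite exprn_gt0.
pose L := (2 * D + 1) ^+ 2.
pose n := (Num.truncn (L / (t ^+ 2 * c))).+1.
have n0 : (0 : R) < n%:R by rewrite ltr0n.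
have nL : L / n%:R <= t ^+ 2 * c.
  rewrite ler_pdivrMr // mulrC -ler_pdivrMr ?mulr_gt0 //.
  exact/ltW/truncnS_gt.
exists (bump D th n); set p := bump D th n.
have pE x : x \in `[- D, D] -> exists y : R,
    [/\ 0 <= y <= 1, (th - x) ^+ 2 = L * y & p.[x] = (1 - y) ^+ n] by exact: bump_itv.
have p1 : p.[th] = 1 by rewrite /p /bump !hornerE subrr ?expr0n /= !mulr0 subr0 expr1n.
clearbody p.
have cp : c <= linform m p.
  have := LG p; rewrite p1 mulr1; apply=> x /pE[y [/andP[y0 y1] _ ->]].
  by rewrite exprn_ge0 // subr_ge0.
have h1 : linform m (p ^+ 2) <= linform m p.
  rewrite -subr_ge0 -linformN -linformD; apply: le_trans (LG (p - p ^+ 2) _).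
    by rewrite !hornerE p1 expr1n subrr mulr0.
  move=> x /pE[y [/andP[y0 y1] _ xE]]; rewrite !hornerE xE.
  have z0 : 0 <= (1 - y) ^+ n by rewrite exprn_ge0 // subr_ge0.
  have z1 : (1 - y) ^+ n <= 1 by rewrite exprn_ile1 //; lra.
  nra.
have m0 : linform m 1 = 1.
  have := linformXn m 0; rewrite expr0 => ->; have := mE 0%N.
  under eq_integral do rewrite expr0.
  rewrite integral_cst // mul1e => h; have := probability_setT nu.
  by move=> h'; move: (etrans (esym h) h') => [].
have h2 : linform m ((th%:P - 'X) ^+ 2 * p ^+ 2) <= L / n%:R.
  rewrite -subr_ge0 -linformN.
  have -> : L / n%:R = linform m (L / n%:R)%:P by rewrite -[(_)%:P]mulr1 mul_polyC linformZ m0 mulr1.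
  rewrite -linformD; apply: le_trans (LG _ _).
    rewrite !hornerE subrr ?expr0n /= !mul0r subr0 mulr_ge0 // divr_ge0 ?sqr_ge0 // ltW.
  move=> x /pE[y [/andP[y0 y1] yE xE]]; rewrite !hornerE xE yE subr_ge0.
  rewrite ler_pdivlMr // -[leRHS]mulr1.
  have z0 : 0 <= (1 - y) ^+ n by rewrite exprn_ge0 // subr_ge0.
  have z1 : (1 - y) ^+ n <= 1 by rewrite exprn_ile1 //; lra.
  have b := @bernoulli_le _ y n; rewrite y0 y1 in b; have {}b := b isT.
  have L0 : 0 <= L by exact: sqr_ge0.
  have : n%:R * y * ((1 - y) ^+ n) ^+ 2 <= 1.
    have w0 : 0 <= n%:R * y by rewrite mulr_ge0 // ltW.
    have := mulr_ge0 w0 z0; nra.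
  move/(ler_wpM2l L0) => h.
  suff : L * y * (1 - y) ^+ n * (1 - y) ^+ n * n%:R <= L * 1 by [].
  lra.
split=> //; have := ler_wpM2l (ltW t20) h1; have := ler_wpM2l (ltW t20) cp; lra.
Qed.

(** * Automorphism invariance of the moments, and finite balls *)

Section Automorphism.
Variables (V : choiceType) (adj : rel V) (f g : V -> V).
Hypotheses (fK : cancel f g) (gK : cancel g f).
Hypothesis f_adj : forall x y, adj (f x) (f y) = adj x y.

Lemma is_path_from_map u s : is_path_from adj (f u) (map f s) <-> is_path_from adj u s.
Proof.
rewrite /is_path_from -map_cons (map_inj_uniq (can_inj fK)) path_map.
by rewrite (@eq_path _ (relpre f adj) adj) // => x y; exact: f_adj.
Qed.

Lemma path_tree_adj_map u s t :
  path_tree_adj adj (f u) (map f s) (map f t) <-> path_tree_adj adj u s t.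
Proof.
have rc s' t' : (exists x, map f t' = rcons (map f s') x) <-> exists x, t' = rcons s' x.
  split=> -[x E]; last by exists (f x); rewrite E map_rcons.
  by exists (g x); rewrite -(mapK fK t') E map_rcons (mapK fK).
by rewrite /path_tree_adj !is_path_from_map !rc.
Qed.

Lemma path_tree_moment_automorphism (R : realType) u n :
  path_tree_moment R adj (f u) n = path_tree_moment R adj u n.
Proof.
suff H s : iter n (path_tree_op adj (f u)) (@root_indicator R V) (map f s) =
    iter n (path_tree_op adj u) (@root_indicator R V) s by exact: (H [::]).
elim: n s => [|n IH] s /=; first by rewrite /root_indicator; case: s.
rewrite /path_tree_op (@reindex_fsbig _ _ _ _ _ (map f) [set t | path_tree_adj adj u s t]%classic).
  by apply: eq_fsbigr => t _; exact: IH.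
split=> [t /= /path_tree_adj_map //|t t' _ _|t /= st].
  exact: (inj_map (can_inj fK)).
exists (map g t); last exact: mapK gK _.
by apply/path_tree_adj_map; rewrite (mapK gK).
Qed.

End Automorphism.

(** Add all neighbours [N] times; bounded degree keeps each stage finite. One [S] serves all of [K],
    as [thick] compares its vertices within a single set. *)
Lemma finite_neighborhood (V : choiceType) (adj : rel V) (D N : nat) (K : seq V) :
  max_degree_le adj D -> exists S : {fset V}, {in K, forall u s,
    is_path_from adj u s -> (size s <= N)%N -> {subset u :: s <= S}}.
Proof.
move=> /choice[nb nbP].
have nbE v w : adj v w = (w \in nb v) by have [_ _ ->] := nbP v.
pose step (T : seq V) := T ++ flatten (map nb T).
have step_sub T : {subset T <= step T} by move=> x xT; rewrite mem_cat xT.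
have iter_sub n T : {subset T <= iter n step T}.
  by elim: n => //= n IH x /IH; exact: step_sub.
exists [fset x in iter N step K] => u uK s [ps _] sN x xus.
rewrite !inE /=; elim: N K u s ps sN x xus uK => [|N IH] K u s ps sN x xus uK.
  by case: s sN ps xus => // _ _; rewrite inE => /eqP->.
case: s ps sN xus => [_ _|y s /= /andP[uy ps] sN].
  by rewrite inE => /eqP->; exact: iter_sub.
rewrite inE -iterS iterSr => /orP[/eqP->|xs]; first exact/iter_sub/step_sub.
apply: (IH _ y s) => //; rewrite mem_cat; apply/orP; right.
by apply/flattenP; exists (nb u); rewrite ?map_f // -nbE.
Qed.

(** * From an atom to thick windows *)

Unset Implicit Arguments.
Local Close Scope fset_scope.

Theorem theorem1p1 (R : realType) (V : choiceType) (adj : rel V) (D : nat) (o : V)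
    (nu : probability R R) :
  simple_graph adj ->
  infinite_set [set: V] ->
  connected_graph adj ->
  vertex_transitive adj ->
  max_degree_le adj D ->
  @is_matching_measure R V adj D o nu ->
  forall theta : R, nu [set theta] = 0%E.
Proof.
move=> sg infV conn vt deg [nuB mom] th.
pose m := path_tree_moment R adj o.
(* The zeroth moment is the total mass 1; the others are given. *)
have mE n : (\int[nu]_x (x ^+ n)%:E = (m n)%:E)%E.
  case: n => [|n]; last exact: mom.
  under eq_integral do rewrite expr0.
  rewrite integral_cst // mul1e; apply: etrans (probability_setT nu) _.
  by rewrite /m /path_tree_moment /= /root_indicator eqxx.
have [thB|thB] := boolP (th \in `[- D%:R, D%:R]); last first.
  apply/eqP; rewrite -measure_le0.
  have <- : nu (~` `[(- D%:R : R), D%:R])%classic = 0%E.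
    by rewrite probability_setC ?nuB ?subee //; exact: measurable_itv.
  apply: le_measure; try (apply/mem_set => //=).
  - by apply: measurableC; exact: measurable_itv.
  - by move=> x -> /=; apply/negP.
have [c0|c0] := ltP 0 (fine (nu [set th]%classic)); last first.
  have : fine (nu [set th]%classic) = 0 by apply/eqP; rewrite eq_le c0 fine_ge0.
  by move=> h; rewrite -[LHS]fineK ?h // fin_num_measure.
have c20 : 0 < fine (nu [set th]%classic) / 2 by rewrite divr_gt0.
(* Half the atom's mass is the constant [a] of [thick]. The polynomial depends on [t], and so does
   the radius of the ball that [S] must contain. *)
exfalso; apply: (no_thick (th := th) o sg infV conn c20) => K t t0.
have [p [cp pb]] := moment_bump_bound nuB mE (ler0n _ D) thB c0 t0.
have [S HS] := finite_neighborhood (size p + size p + 4).+1 K deg.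
exists S; split=> v vK; first by apply: (HS v vK [::]) => //; rewrite mem_head.
have [f [[[g fK gK] fadj] fo]] := vt o v.
(* By transitivity the [p] built from the moments at [o] works at every [v] in [K]. *)
have mvE : path_tree_moment R adj v = m.
  by apply/funext => n; rewrite -fo; exact: path_tree_moment_automorphism fK gK fadj _ _ _.
have := resolvent_mass sg.1 t0 (HS v vK) (leqnn _); rewrite mvE => /(_ _ pb).
apply: le_trans; rewrite ler_wpM2r ?normc_ge0 // ler_pM2r //.
Qed.
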